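(* Let $(\mathcal E,\mathfrak a,\mathfrak b)$ be a quasi-twilled Lie conformal algebra and $B:\mathfrak b\to\mathfrak a$ a left deformation map. Define $\varrho^B_{\mathfrak b}:\mathfrak b\to\mathrm{Cend}(\mathfrak a)$ by $$\varrho^B_{\mathfrak b}(u)_\lambda a=\{B(u)_\lambda a\}_{\mathfrak a}+\varrho_{\mathfrak b}(u)_\lambda a+B\bigl(\varrho_{\mathfrak a}(a)_{-\lambda-\partial}u\bigr)-B\bigl(\psi_{1,\lambda}(B(u),a)\bigr),\qquad u\in\mathfrak b,\ a\in\mathfrak a.$$ Then $(\mathfrak a,\varrho^B_{\mathfrak b})$ is a representation of the Lie conformal algebra $\mathfrak b^B$, where $\mathfrak b^B$ is the $\mathbb C[\partial]$-module $\mathfrak b$ equipped with the $\lambda$-bracket $\{u_\lambda v\}^B_{\mathfrak b}=\{u_\lambda v\}_{\mathfrak b}+\varrho_{\mathfrak a}(B(u))_\lambda v-\varrho_{\mathfrak a}(B(v))_{-\lambda-\partial}u+\psi_{1,\lambda}(B(u),B(v))$.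
   Context: All vector spaces and linear maps are over $\mathbb C$, and all $\mathbb C[\partial]$-modules are finitely generated. A Lie conformal algebra is a $\mathbb C[\partial]$-module $\mathcal E$ with a $\mathbb C$-linear map $\mathcal E\otimes\mathcal E\to\mathcal E[\lambda]$, $x\otimes y\mapsto\{x_\lambda y\}$, such that $\{\partial x_\lambda y\}=-\lambda\{x_\lambda y\}$, $\{x_\lambda\partial y\}=(\partial+\lambda)\{x_\lambda y\}$, $\{x_\lambda y\}=-\{y_{-\lambda-\partial}x\}$ and $\{x_\lambda\{y_\mu z\}\}=\{\{x_\lambda y\}_{\lambda+\mu}z\}+\{y_\mu\{x_\lambda z\}\}$. The subscript $-\lambda-\partial$ means that the formal variable is replaced by $-\lambda-\partial$, with $\partial$ acting from the left on the coefficients. $\mathbb C[\partial]$-module maps are extended to polynomials coefficientwise. For a $\mathbb C[\partial]$-module $M$, $\mathrm{Cend}(M)$ is the space of $\mathbb C$-linear maps $f_\lambda:M\to M[\lambda]$ with $f_\lambda(\partial m)=(\partial+\lambda)f_\lambda m$. A representation (module) of a Lie conformal algebra $\mathcal E$ is a $\mathbb C[\partial]$-module $M$ with a $\mathbb C$-linear map $\varrho:\mathcal E\to\mathrm{Cend}(M)$ such that $\varrho(\partial x)_\lambda=-\lambda\varrho(x)_\lambda$ and $\varrho(x)_\lambda\varrho(y)_\mu-\varrho(y)_\mu\varrho(x)_\lambda=\varrho(\{x_\lambda y\})_{\lambda+\mu}$. A quasi-twilled Lie conformal algebra $(\mathcal E,\mathfrak a,\mathfrak b)$ is a Lie conformal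 algebra $\mathcal E$ with a decomposition $\mathcal E=\mathfrak a\oplus\mathfrak b$ of $\mathbb C[\partial]$-modules such that $\mathfrak b$ is a Lie conformal subalgebra. With $\mathrm{pr}_{\mathfrak a},\mathrm{pr}_{\mathfrak b}$ the projections, for $a,b\in\mathfrak a$, $u,v\in\mathfrak b$ set $\{a_\lambda b\}_{\mathfrak a}=\mathrm{pr}_{\mathfrak a}\{a_\lambda b\}$, $\psi_{1,\lambda}(a,b)=\mathrm{pr}_{\mathfrak b}\{a_\lambda b\}$, $\varrho_{\mathfrak b}(u)_\lambda a=\mathrm{pr}_{\mathfrak a}\{u_\lambda a\}$, $\varrho_{\mathfrak a}(a)_\lambda v=\mathrm{pr}_{\mathfrak b}\{a_\lambda v\}$, $\{u_\lambda v\}_{\mathfrak b}=\mathrm{pr}_{\mathfrak b}\{u_\lambda v\}=\{u_\lambda v\}$. A left deformation map of $(\mathcal E,\mathfrak a,\mathfrak b)$ is a $\mathbb C[\partial]$-module homomorphism $B:\mathfrak b\to\mathfrak a$ whose graph $\mathrm{Gr}(B)=\{(B(u),u)\mid u\in\mathfrak b\}\subset\mathcal E$ is a Lie conformal subalgebra of $\mathcal E$. For such $B$, the bracket $\{\cdot_\lambda\cdot\}^B_{\mathfrak b}$ is a Lie conformal algebra structure on $\mathfrak b$. *)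

(* Defs.v *)
From HB Require Import structures.
From mathcomp Require Import all_boot all_order all_algebra.
From mathcomp Require Import finmap monalg.

Set Implicit Arguments.
Unset Strict Implicit.
Unset Printing Implicit Defensive.

Import GRing.Theory.
Local Open Scope ring_scope.

(* [lpoly M] is M[X], the finitely supported sequences of elements of an
   A-module M; it is a module over A[X].  With A = K[d] this gives M[lambda] as
   a K[d][lambda]-module and, by iteration, M[lambda][mu] as a
   K[d][lambda][mu]-module. *)
Definition lpoly (A : nzRingType) (M : lmodType A) := {malg M[nat]}.

HB.instance Definition _ (A : nzRingType) (M : lmodType A) :=
  GRing.Zmodule.on (lpoly M).

Section LPolyModule.
Variables (A : nzRingType) (M : lmodType A).
Implicit Types (q : {poly A}) (p : lpoly M).

Definition lpoly_scale q p : lpoly M :=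
  \sum_(i < size q) \sum_(j <- msupp p) << q`_i *: p@_j *g (i + j)%N >>.

Lemma lpoly_scaleE q p k :
  (lpoly_scale q p)@_k = \sum_(i < k.+1) q`_i *: p@_(k - i)%N.
Proof.
have inner (i : nat) :
  (\sum_(j <- msupp p) << q`_i *: p@_j *g (i + j)%N >>)@_k
    = if (i < k.+1)%N then q`_i *: p@_(k - i)%N else 0.
  rewrite raddf_sum /=.
  under eq_bigr do rewrite mcoeffU.
  case: ltnP => [le_ik | lt_ki]; last first.
    rewrite big1 // => j _; rewrite gtn_eqF ?mulr0n //.
    exact: leq_trans lt_ki (leq_addr _ _).
  have eqj j : (i + j == k)%N = (j == k - i)%N.
    by rewrite -(eqn_add2l i j (k - i)) subnKC.
  under eq_bigr do rewrite eqj.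
  case: (boolP ((k - i)%N \in msupp p)) => supp.
    rewrite (big_rem _ supp) /= eqxx mulr1n big_seq big1 ?addr0 // => j.
    by rewrite mem_rem_uniq ?fset_uniq // inE => /andP[/negPf-> _].
  rewrite (mcoeff_outdom supp) scaler0 big_seq big1 // => j jp.
  case: eqP => [ej|]; last by rewrite mulr0n.
  by rewrite -ej jp in supp.
rewrite raddf_sum /=; under eq_bigr do rewrite inner.
rewrite -big_mkcond /=.
rewrite (big_ord_widen_cond (maxn (size q) k.+1) (fun i => (i < k.+1)%N)
   (fun i => q`_i *: p@_(k - i)%N)) ?leq_maxl //.
rewrite [RHS](big_ord_widen (maxn (size q) k.+1)
   (fun i => q`_i *: p@_(k - i)%N)) ?leq_maxr //.
rewrite [LHS]big_mkcond [RHS]big_mkcond; apply: eq_bigr => i _ /=.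
case: (i < k.+1)%N => //=; case: ltnP => // le_qi.
by rewrite nth_default ?scale0r.
Qed.

Fact lpoly_scaleA q1 q2 p :
  lpoly_scale q1 (lpoly_scale q2 p) = lpoly_scale (q1 * q2) p.
Proof.
apply/malgP => k; rewrite !lpoly_scaleE.
pose F i j := (q1`_i * q2`_j) *: p@_(k - (i + j))%N.
transitivity (\sum_(i < k.+1) \sum_(j < k.+1 | (i <= j)%N) F i (j - i)%N).
  apply: eq_bigr => i _; rewrite lpoly_scaleE scaler_sumr.
  have le_ik : (i <= k)%N by rewrite -ltnS.
  rewrite -(big_mkord xpredT (fun j => q1`_i *: (q2`_j *: p@_(k - i - j)%N))).
  rewrite -(big_mkord (fun j => (i <= j)%N) (fun j => F i (j - i)%N)).
  rewrite [RHS](big_cat_nat (n := i)) //=; last exact: ltnW.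
  rewrite [X in _ = X + _]big_nat_cond [X in _ = X + _]big1 ?add0r; last first.
    by move=> j /andP[/andP[_ ltji]]; rewrite leqNgt ltji.
  rewrite -[X in index_iota X k.+1]add0n big_addn subSn // big_nat_cond [RHS]big_nat_cond.
  apply: eq_big => j; first by rewrite leq_addl.
  by move=> _; rewrite /F scalerA addnK subnDA.
rewrite (exchange_big_dep xpredT) //=; apply: eq_bigr => l _.
rewrite coefM scaler_suml -(big_mkord xpredT
   (fun i => (q1`_i * q2`_(l - i)%N) *: p@_(k - l)%N)).
rewrite -(big_mkord (fun i => (i <= l)%N) (fun i => F i (l - i)%N)).
rewrite (big_cat_nat (n := l.+1)) //= [X in _ + X]big_nat_cond.
rewrite [X in _ + X]big1 ?addr0; last first.
  by move=> i /andP[/andP[lt_li _]]; rewrite leqNgt lt_li.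
rewrite big_nat_cond [RHS]big_nat_cond; apply: eq_big => i.
  by rewrite ltnS /=; case: leqP; rewrite ?andbF.
by move=> /andP[_ le_il]; rewrite /F subnKC.
Qed.

Fact lpoly_scale1 : left_id 1 lpoly_scale.
Proof.
move=> p; apply/malgP => k; rewrite lpoly_scaleE big_ord_recl coef1 scale1r.
by rewrite subn0 big1 ?addr0 // => i _; rewrite coef1 scale0r.
Qed.

Fact lpoly_scaleDr : right_distributive lpoly_scale +%R.
Proof.
move=> q p1 p2; apply/malgP => k; rewrite mcoeffD !lpoly_scaleE -big_split.
by apply: eq_bigr => i _; rewrite mcoeffD scalerDr.
Qed.

Fact lpoly_scaleDl p : {morph lpoly_scale^~ p : q1 q2 / q1 + q2}.
Proof.
move=> q1 q2; apply/malgP => k; rewrite mcoeffD !lpoly_scaleE -big_split.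
by apply: eq_bigr => i _; rewrite coefD scalerDl.
Qed.

HB.instance Definition _ := GRing.Zmodule_isLmodule.Build {poly A} (lpoly M)
  lpoly_scaleA lpoly_scale1 lpoly_scaleDr lpoly_scaleDl.

End LPolyModule.

Definition lconst (A : nzRingType) (M : lmodType A) (m : M) : lpoly M :=
  << m *g 0%N >>.

(* Coefficientwise extension of a map f with f 0 = 0. *)
Definition lmap (A B : nzRingType) (M : lmodType A) (N : lmodType B) (f : M -> N)
    (p : lpoly M) : lpoly N :=
  [malg n in msupp p => f p@_n].

(* [lsubst t h p] is the image of p = sum_n m_n X^n under X |-> t and m |-> h m,
   that is sum_n t^n *: h m_n. *)
Definition lsubst (A B : nzRingType) (M : lmodType A) (W : lmodType B)
    (t : B) (h : M -> W) (p : lpoly M) : W :=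
  \sum_(n <- msupp p) t ^+ n *: h p@_n.

Section LieConformal.
Variable K : fieldType.

(* A K[d]-module is an [lmodType {poly K}] on which 'X acts as d. *)
Local Notation "'d'" := ('X : {poly K}).
(* In M[lambda], a module over K[d][lambda]. *)
Local Notation "'d1'" := ('X%:P : {poly {poly K}}).
Local Notation "'la'" := ('X : {poly {poly K}}).
(* In M[lambda][mu], a module over K[d][lambda][mu]. *)
Local Notation "'la2'" := ('X%:P : {poly {poly {poly K}}}).
Local Notation "'mu2'" := ('X : {poly {poly {poly K}}}).

Definition fin_gen (M : lmodType {poly K}) : Prop :=
  exists (n : nat) (g : 'I_n -> M),
    forall m : M, exists q : 'I_n -> {poly K}, m = \sum_(i < n) q i *: g i.

Definition is_Klinear (M N : lmodType {poly K}) (f : M -> lpoly N) : Prop :=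
  forall (c : K) (x y : M), f (c%:P *: x + y) = c%:P%:P *: f x + f y.

(* p(- lambda - d), with d acting from the left on the coefficients. *)
Definition skew_subst (M : lmodType {poly K}) (p : lpoly M) : lpoly M :=
  lsubst (- la - d1) (@lconst _ M) p.

Definition is_cend (M : lmodType {poly K}) (f : M -> lpoly M) : Prop :=
  is_Klinear f /\ forall m : M, f (d *: m) = (d1 + la) *: f m.

(* f_lambda (g_mu m) *)
Definition comp_lm (M : lmodType {poly K}) (f g : M -> lpoly M) (m : M) :
    lpoly (lpoly M) :=
  lmap f (g m).

(* g_mu (f_lambda m): the coefficients in mu of g_mu c are embedded in
   M[lambda] as constants. *)
Definition comp_ml (M : lmodType {poly K}) (g f : M -> lpoly M) (m : M) :
    lpoly (lpoly M) :=
  lsubst la2 (fun c : M => lmap (@lconst _ M) (g c)) (f m).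

(* rho (w_lambda)_{lambda + mu} m, for w_lambda in E[lambda] *)
Definition act_sum (E M : lmodType {poly K}) (rho : E -> M -> lpoly M)
    (w : lpoly E) (m : M) : lpoly (lpoly M) :=
  lsubst la2
    (fun c : E => lsubst (la2 + mu2) (fun n : M => lconst (lconst n)) (rho c m))
    w.

Record is_lie_conformal (E : lmodType {poly K}) (br : E -> E -> lpoly E) :
    Prop := IsLieConformal {
  lca_fin_gen : fin_gen E;
  lca_linear_l : forall y : E, is_Klinear (br^~ y);
  lca_linear_r : forall x : E, is_Klinear (br x);
  lca_sesqui_l : forall x y : E, br (d *: x) y = - la *: br x y;
  lca_sesqui_r : forall x y : E, br x (d *: y) = (d1 + la) *: br x y;
  lca_skew : forall x y : E, br x y = - skew_subst (br y x);
  lca_jacobi : forall x y z : E,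
    comp_lm (br x) (br y) z
      = act_sum br (br x y) z + comp_ml (br y) (br x) z
}.

(* (M, rho) is a representation of the Lie conformal algebra (E, br). *)
Record is_representation (E M : lmodType {poly K}) (br : E -> E -> lpoly E)
    (rho : E -> M -> lpoly M) : Prop := IsRepresentation {
  rep_lca : is_lie_conformal br;
  rep_fin_gen : fin_gen M;
  rep_cend : forall x : E, is_cend (rho x);
  rep_linear : forall m : M, is_Klinear (rho^~ m);
  rep_sesqui : forall (x : E) (m : M), rho (d *: x) m = - la *: rho x m;
  rep_bracket : forall (x y : E) (m : M),
    comp_lm (rho x) (rho y) m - comp_ml (rho y) (rho x) m
      = act_sum rho (br x y) m
}.

Record is_conformal_subalgebra (E : lmodType {poly K})
    (br : E -> E -> lpoly E) (S : E -> Prop) : Prop := IsConformalSubalgebra {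
  sub_zero : S 0;
  sub_add : forall x y : E, S x -> S y -> S (x + y);
  sub_scale : forall (q : {poly K}) (x : E), S x -> S (q *: x);
  sub_bracket : forall x y : E, S x -> S y -> forall n : nat, S (br x y)@_n
}.

(* E = a (+) b, given by the inclusions of the two summands and the
   projections onto them; a submodule may be presented by any module that
   embeds onto it. *)
Record direct_sum (E a b : lmodType {poly K}) := DirectSum {
  in_a : {linear a -> E};
  in_b : {linear b -> E};
  pr_a : {linear E -> a};
  pr_b : {linear E -> b};
  pr_a_in_a : forall x : a, pr_a (in_a x) = x;
  pr_b_in_b : forall u : b, pr_b (in_b u) = u;
  pr_a_in_b : forall u : b, pr_a (in_b u) = 0;
  pr_b_in_a : forall x : a, pr_b (in_a x) = 0;
  in_pr : forall e : E, in_a (pr_a e) + in_b (pr_b e) = e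
}.

Section QuasiTwilled.
Variables (E a b : lmodType {poly K}) (D : direct_sum E a b).
Variable br : E -> E -> lpoly E.

Definition is_quasi_twilled : Prop :=
  is_lie_conformal br /\
  is_conformal_subalgebra br (fun e => exists u : b, e = in_b D u).

Definition br_a (x y : a) : lpoly a :=
  lmap (pr_a D) (br (in_a D x) (in_a D y)).
Definition psi1 (x y : a) : lpoly b :=
  lmap (pr_b D) (br (in_a D x) (in_a D y)).
Definition rho_b (u : b) (x : a) : lpoly a :=
  lmap (pr_a D) (br (in_b D u) (in_a D x)).
Definition rho_a (x : a) (v : b) : lpoly b :=
  lmap (pr_b D) (br (in_a D x) (in_b D v)).
Definition br_b (u v : b) : lpoly b :=
  lmap (pr_b D) (br (in_b D u) (in_b D v)).

Definition is_left_deformation_map (B : {linear b -> a}) : Prop :=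
  is_conformal_subalgebra br
    (fun e => exists u : b, e = in_a D (B u) + in_b D u).

Definition deformed_bracket (B : {linear b -> a}) (u v : b) : lpoly b :=
  br_b u v + rho_a (B u) v - skew_subst (rho_a (B v) u) + psi1 (B u) (B v).

Definition deformed_rho (B : {linear b -> a}) (u : b) (x : a) : lpoly a :=
  br_a (B u) x + rho_b u x + lmap B (skew_subst (rho_a x u))
    - lmap B (psi1 (B u) x).

End QuasiTwilled.
End LieConformal.

(* Main.v *)
Require Import Defs.
From HB Require Import structures.
From mathcomp Require Import all_boot all_order all_algebra.
From mathcomp Require Import finmap monalg.
From mathcomp Require Import boolp reals complex.

Set Implicit Arguments.
Unset Strict Implicit.
Unset Printing Implicit Defensive.

(** Write [s u = B u + u] for the parametrization of the graph Gr(B) by b.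
    Since [B] has values in a, E is the direct sum of a and Gr(B); the
    corresponding projections are [p e = pr_a e - B (pr_b e)] onto a, and
    [s (pr_b e)] onto Gr(B).  By skew-symmetry of the bracket of E, the two
    deformed operations are
      [{u_lambda v}^B = pr_b {s u _lambda s v}] and
      [rho^B(u)_lambda x = p {s u _lambda x}]
    (lemmas [deformed_bracketE] and [deformed_rhoE]).

    As Gr(B) is a subalgebra, the first formula says that [s] carries the
    deformed bracket of b to the bracket of Gr(B), and the second one that a,
    identified with E / Gr(B) through [p], carries the action of Gr(B) on that
    quotient of its adjoint action on E.  Hence [s] is an injective
    intertwiner and [p] a surjective one, and the Jacobi identity of E can be
    pulled back along [s] to give that of b, and pushed forward along [p] to
    give the bracket axiom of the representation ([pullback_lie_conformal] and
    [quotient_representation]).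

    Both transfers rest on the three operations of the Jacobi identity being
    natural in the module they act on ([comp_lm_intertwine],
    [comp_ml_intertwine], [act_sum_intertwine]), which in turn reduces to the
    naturality of coefficientwise extension and of substitution. *)

Import GRing.Theory.
Local Open Scope fset_scope.
Local Open Scope ring_scope.

(** * Coefficientwise extension and substitution *)

Lemma lconst0 (A : nzRingType) (M : lmodType A) : lconst (0 : M) = 0.
Proof. exact: monalgU0. Qed.

Section Lmap.
Variables (A B : nzRingType) (M : lmodType A) (N : lmodType B).
Implicit Types (f : M -> N) (p : lpoly M).

Lemma lmap_coef f p k : f 0 = 0 -> (lmap f p)@_k = f p@_k.
Proof.
by move=> f0; rewrite mcoeffE; case: ifPn => // /mcoeff_outdom ->.
Qed.

Lemma lmap_const f m : f 0 = 0 -> lmap f (lconst m) = lconst (f m).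
Proof.
move=> f0; apply/malgP => k; rewrite lmap_coef // !mcoeffU.
by case: eqP => //; rewrite !mulr0n.
Qed.

Lemma lmap0 f : f 0 = 0 -> lmap f 0 = 0.
Proof. by move=> f0; apply/malgP => k; rewrite lmap_coef // !mcoeff0. Qed.

Lemma eq_lmap f g p : f =1 g -> lmap f p = lmap g p.
Proof.
by move=> efg; apply/malgP => k; rewrite !mcoeffE efg.
Qed.

End Lmap.

Lemma lmap_comp (A B C : nzRingType) (M : lmodType A) (N : lmodType B)
    (P : lmodType C) (f : M -> N) (g : N -> P) (p : lpoly M) :
  f 0 = 0 -> g 0 = 0 -> lmap g (lmap f p) = lmap (g \o f) p.
Proof.
move=> f0 g0; apply/malgP => k.
by rewrite !lmap_coef //= f0.
Qed.

Section LmapLinear.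
Variables (A : nzRingType) (M N : lmodType A) (f : {linear M -> N}).

Fact lmap_is_linear : linear (lmap f : lpoly M -> lpoly N).
Proof.
move=> q p1 p2; apply/malgP => k.
rewrite mcoeffD !lmap_coef ?raddf0 // mcoeffD raddfD /= !lpoly_scaleE.
rewrite raddf_sum; congr (_ + _); apply: eq_bigr => i _.
by rewrite /= linearZ lmap_coef ?raddf0.
Qed.

(** Registering [lmap f] as linear over [{poly A}] makes the construction
    iterable: [lmap (lmap f)] is then linear over [{poly {poly A}}], hence
    commutes with substitutions of polynomials in lambda and mu. *)
HB.instance Definition _ :=
  GRing.isLinear.Build {poly A} (lpoly M) (lpoly N) *:%R (lmap f)
    lmap_is_linear.

End LmapLinear.

Lemma lmap_inj (A : nzRingType) (M N : lmodType A) (f : {linear M -> N})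
    (g : N -> M) :
  cancel f g -> injective (lmap f).
Proof.
move=> fK p q /malgP epq; apply/malgP => k; apply: (can_inj fK).
by have := epq k; rewrite !lmap_coef ?raddf0.
Qed.

Section Lsubst.
Variables (A B : nzRingType) (M : lmodType A) (W : lmodType B) (t : B).
Implicit Types (h : M -> W) (p : lpoly M).

Lemma lsubst_widen h p (S : {fset nat}) :
    h 0 = 0 -> msupp p `<=` S ->
  lsubst t h p = \sum_(n <- S) t ^+ n *: h p@_n.
Proof.
move=> h0 sub; apply: big_fset_incl => // n _ /mcoeff_outdom ->.
by rewrite h0 scaler0.
Qed.

Lemma eq_lsubst h1 h2 p : h1 =1 h2 -> lsubst t h1 p = lsubst t h2 p.
Proof. by move=> eqh; apply: eq_bigr => n _; rewrite eqh. Qed.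

(** The support of [lmap f p] may be smaller than that of [p], so the two sums
    are compared over a common finite set of exponents; this is where
    [h 0 = 0] matters. *)
Lemma lsubst_lmap (C : nzRingType) (L : lmodType C) (f : L -> M) h
    (p : lpoly L) :
  f 0 = 0 -> h 0 = 0 -> lsubst t h (lmap f p) = lsubst t (h \o f) p.
Proof.
move=> f0 h0; pose S := msupp (lmap f p) `|` msupp p.
rewrite (@lsubst_widen h _ S) ?fsubsetUl //.
rewrite /lsubst [RHS](@big_fset_incl _ _ _ _ _ S) ?fsubsetUr //=.
  by apply: eq_bigr => n _; rewrite lmap_coef.
by move=> n _ /mcoeff_outdom ->; rewrite f0 h0 scaler0.
Qed.

Lemma linear_lsubst (V : lmodType B) (f : {linear W -> V}) h p :
  f (lsubst t h p) = lsubst t (f \o h) p.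
Proof. by rewrite raddf_sum; apply: eq_bigr => n _; rewrite /= linearZ. Qed.

End Lsubst.

(** * Naturality of the terms of the Jacobi identity *)

Section Transfer.
Variable K : fieldType.
Implicit Types E M N L : lmodType {poly K}.

Lemma Klinear0 M N (f : M -> lpoly N) : is_Klinear f -> f 0 = 0.
Proof.
move=> lf; have := lf 1 0 0; rewrite scaler0 addr0 !polyC1 scale1r.
by move/(congr1 (fun x => x - f 0)); rewrite addrK subrr.
Qed.

Lemma KlinearD M N (f : M -> lpoly N) x y :
  is_Klinear f -> f (x + y) = f x + f y.
Proof. by move=> lf; have := lf 1 x y; rewrite !polyC1 !scale1r. Qed.

Lemma skew_subst_lmap M N (f : {linear M -> N}) (p : lpoly M) :
  skew_subst (lmap f p) = lmap f (skew_subst p).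
Proof.
rewrite /skew_subst lsubst_lmap ?raddf0 ?lconst0 // linear_lsubst.
by apply: eq_lsubst => m /=; rewrite lmap_const ?raddf0.
Qed.

(** For [f] intertwining the operators on [M] with those on [N], each composite
    on [N], evaluated at [f m], is the image of the composite on [M].  Reading
    this on the left gives identities on the image of [f], reading it on the
    right gives identities on [M] when [f] is injective. *)
Section Intertwiner.
Variables (M N : lmodType {poly K}) (f : {linear M -> N}).

Lemma comp_lm_intertwine (g h : M -> lpoly M) (g' h' : N -> lpoly N) m :
    g 0 = 0 -> g' 0 = 0 ->
    (forall x, g' (f x) = lmap f (g x)) ->
    (forall x, h' (f x) = lmap f (h x)) ->
  comp_lm g' h' (f m) = lmap (lmap f) (comp_lm g h m).
Proof.
move=> g0 g'0 fg fh; rewrite /comp_lm fh !lmap_comp ?raddf0 //.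
exact/eq_lmap/fg.
Qed.

Lemma comp_ml_intertwine (g h : M -> lpoly M) (g' h' : N -> lpoly N) m :
    g' 0 = 0 ->
    (forall x, g' (f x) = lmap f (g x)) ->
    (forall x, h' (f x) = lmap f (h x)) ->
  comp_ml g' h' (f m) = lmap (lmap f) (comp_ml g h m).
Proof.
move=> g'0 fg fh; rewrite /comp_ml fh.
rewrite lsubst_lmap ?raddf0 ?g'0 ?lmap0 ?lconst0 // linear_lsubst.
apply: eq_lsubst => c /=; rewrite fg !lmap_comp ?raddf0 ?lconst0 //.
by apply: eq_lmap => x /=; rewrite lmap_const ?raddf0.
Qed.

Lemma act_sum_intertwine L (rho : L -> M -> lpoly M) (rho' : L -> N -> lpoly N)
    (w : lpoly L) m :
    (forall c x, rho' c (f x) = lmap f (rho c x)) ->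
  act_sum rho' w (f m) = lmap (lmap f) (act_sum rho w m).
Proof.
move=> frho; rewrite /act_sum linear_lsubst; apply: eq_lsubst => c /=.
rewrite frho lsubst_lmap ?raddf0 ?lconst0 // linear_lsubst.
by apply: eq_lsubst => x /=; rewrite !lmap_const ?raddf0 ?lconst0 ?lmap0 ?raddf0.
Qed.

End Intertwiner.

(** Restriction of an action along [s]: it trades a bracket computed in the
    subalgebra for the bracket of the ambient algebra. *)
Lemma act_sum_restrict L E M (s : {linear L -> E}) (rho : E -> M -> lpoly M)
    (w : lpoly L) m :
    rho 0 m = 0 ->
  act_sum rho (lmap s w) m = act_sum (fun c => rho (s c)) w m.
Proof.
move=> rho0; rewrite /act_sum lsubst_lmap ?raddf0 //.
by rewrite rho0 /lsubst msupp0 big_seq_fset0.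
Qed.

Lemma fin_gen_image M N (f : {linear M -> N}) (g : N -> M) :
  cancel g f -> fin_gen M -> fin_gen N.
Proof.
move=> gK [n [e eP]]; exists n, (f \o e) => m.
have [q /(congr1 f) fq] := eP (g m); exists q.
by rewrite -[LHS]gK fq raddf_sum; apply: eq_bigr => i _; rewrite /= linearZ.
Qed.

Lemma Klinear_comp M N L L' (s : {linear M -> N}) (r : {linear L -> L'})
    (f : N -> lpoly L) :
  is_Klinear f -> is_Klinear (fun x => lmap r (f (s x))).
Proof. by move=> lf c x y; rewrite linearP lf linearP. Qed.

End Transfer.

(** * Subalgebras and the quotient of the adjoint action *)

(** [s] presents a subalgebra of [E] as the module [L], with retraction [r];
    the condition [s_closed] says that each coefficient of a bracket of two
    elements of the image of [s] is again in that image. *)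
Section Subquotient.
Variables (K : fieldType) (E L N : lmodType {poly K}).
Variable br : E -> E -> lpoly E.
Hypothesis brP : is_lie_conformal br.
Variables (s : {linear L -> E}) (r : {linear E -> L}).
Hypothesis sK : cancel s r.
Hypothesis s_closed : forall u v : L,
  lmap s (lmap r (br (s u) (s v))) = br (s u) (s v).

Definition pullback_bracket (u v : L) : lpoly L := lmap r (br (s u) (s v)).

Let br0 x : br x 0 = 0. Proof. exact: Klinear0 (lca_linear_r brP x). Qed.
Let br_l0 x : br 0 x = 0.
Proof. exact: (Klinear0 (lca_linear_l brP x)). Qed.

Lemma pullback_lie_conformal : is_lie_conformal pullback_bracket.
Proof.
have pull0 u : pullback_bracket u 0 = 0.
  by rewrite /pullback_bracket !raddf0 br0 raddf0.
have s_br u v : br (s u) (s v) = lmap s (pullback_bracket u v).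
  by rewrite s_closed.
split.
- exact: fin_gen_image sK (lca_fin_gen brP).
- move=> v; exact: (Klinear_comp s r (lca_linear_l brP (s v))).
- move=> u; exact: (Klinear_comp s r (lca_linear_r brP (s u))).
- by move=> u v; rewrite /pullback_bracket linearZ lca_sesqui_l // linearZ.
- by move=> u v; rewrite /pullback_bracket linearZ lca_sesqui_r // linearZ.
- move=> u v; rewrite /pullback_bracket skew_subst_lmap -raddfN.
  by rewrite -lca_skew.
(* The Jacobi identity is checked after applying the injective map s. *)
move=> u v w.
have ssK : cancel (lmap s) (lmap r).
  move=> p; rewrite lmap_comp ?raddf0 //; apply/malgP => k.
  by rewrite lmap_coef /= ?raddf0.
apply: (lmap_inj ssK).
rewrite raddfD /= -(comp_lm_intertwine (g' := br (s u)) (h' := br (s v))) //.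
rewrite -(comp_ml_intertwine (g' := br (s v)) (h' := br (s u))) //.
rewrite -(act_sum_intertwine (rho' := fun c => br (s c))) //.
by rewrite -act_sum_restrict // -s_br lca_jacobi.
Qed.

Variables (p : {linear E -> N}) (j : {linear N -> E}).
Hypothesis jK : cancel j p.
Hypothesis decomp : forall e, e = j (p e) + s (r e).

Let ps0 u : p (s u) = 0.
Proof.
have /(congr1 (fun e => e - s u)) := decomp (s u).
by rewrite sK addrK subrr => /(congr1 p); rewrite raddf0 jK.
Qed.

(** The action of the subalgebra on [E] modulo the subalgebra, transported to
    the complement [N]. *)
Definition quotient_action (u : L) (x : N) : lpoly N := lmap p (br (s u) (j x)).

(** The adjoint action of the subalgebra preserves the subalgebra, which is the
    kernel of [p], so it descends along [p] and does not depend on the lift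
    [j x] of [x]. *)
Lemma quotient_actionE u e : quotient_action u (p e) = lmap p (br (s u) e).
Proof.
rewrite [e in RHS]decomp KlinearD; last exact: lca_linear_r.
rewrite raddfD /= -[X in _ = _ + lmap p X]s_closed lmap_comp ?raddf0 //.
rewrite [X in _ + X](_ : _ = 0) ?addr0 //; apply/malgP => k.
by rewrite lmap_coef /= ?ps0 ?mcoeff0.
Qed.

Lemma quotient_representation :
  is_representation pullback_bracket quotient_action.
Proof.
have act0 u : quotient_action u 0 = 0.
  by rewrite /quotient_action !raddf0 br0 raddf0.
split.
- exact: pullback_lie_conformal.
- exact: fin_gen_image jK (lca_fin_gen brP).
- move=> u; split; first exact: (Klinear_comp j p (lca_linear_r brP (s u))).
  by move=> x; rewrite /quotient_action linearZ lca_sesqui_r // linearZ.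
- move=> x; exact: (Klinear_comp s p (lca_linear_l brP (j x))).
- by move=> u x; rewrite /quotient_action linearZ lca_sesqui_l // linearZ.
(* As p is surjective, x may be replaced by p e; the identity is then the image
   under p of the Jacobi identity for s u, s v and e. *)
move=> u v x; rewrite -{}[x]jK; move: {x}(j x) => e.
have actE := quotient_actionE.
rewrite (comp_lm_intertwine (g := br (s u)) (h := br (s v))) //.
rewrite (comp_ml_intertwine (g := br (s v)) (h := br (s u))) //.
rewrite (act_sum_intertwine (rho := fun c => br (s c))) //.
by rewrite -act_sum_restrict // s_closed lca_jacobi // raddfD /= addrK.
Qed.

End Subquotient.

(** * The graph of a deformation map *)

Section Graph.
Variables (K : fieldType) (E a b : lmodType {poly K}) (D : direct_sum E a b).
Variables (br : E -> E -> lpoly E) (B : {linear b -> a}).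
Hypothesis brP : is_lie_conformal br.

Definition graph_map : {linear b -> E} := (in_a D \o B) \+ in_b D.
(** The projection of [E] onto [a] along the graph of [B]. *)
Definition graph_proj : {linear E -> a} := pr_a D \- (B \o pr_b D).

Lemma graph_mapK : cancel graph_map (pr_b D).
Proof. by move=> u; rewrite /= raddfD /= pr_b_in_a pr_b_in_b add0r. Qed.

Lemma graph_proj_in_a : cancel (in_a D) graph_proj.
Proof. by move=> x; rewrite /= pr_a_in_a pr_b_in_a raddf0 subr0. Qed.

Lemma graph_decomposition e : e = in_a D (graph_proj e) + graph_map (pr_b D e).
Proof. by rewrite /= raddfB /= addrA subrK in_pr. Qed.

Lemma graph_closed : is_left_deformation_map D br B -> forall u v,
  lmap graph_map (lmap (pr_b D) (br (graph_map u) (graph_map v)))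
    = br (graph_map u) (graph_map v).
Proof.
move=> [_ _ _ closed] u v; apply/malgP => k.
have [] := closed _ _ (ex_intro _ u erefl) (ex_intro _ v erefl) k.
rewrite -/(graph_map _) => w brw; rewrite !lmap_coef ?raddf0 // brw.
by rewrite -[in_a D (B w) + _]/(graph_map w) graph_mapK.
Qed.

Lemma pr_b_swap u x :
  lmap (pr_b D) (br (in_b D u) (in_a D x)) = - skew_subst (rho_a D br x u).
Proof. by rewrite skew_subst_lmap -raddfN -lca_skew. Qed.

Lemma deformed_bracketE u v :
  deformed_bracket D br B u v
    = lmap (pr_b D) (br (graph_map u) (graph_map v)).
Proof.
have [lin_l lin_r] := (lca_linear_l brP, lca_linear_r brP).
rewrite /= !(KlinearD _ _ (lin_r _)) (KlinearD _ _ (lin_l _)).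
rewrite (KlinearD _ _ (lin_l (in_b D v))) !raddfD /= pr_b_swap.
rewrite /deformed_bracket /br_b /psi1 -/(rho_a D br (B u) v).
by rewrite [RHS]addrC [X in _ = X + _]addrC [X in _ = _ + X]addrC addrA.
Qed.

Lemma deformed_rhoE u x :
  deformed_rho D br B u x = lmap graph_proj (br (graph_map u) (in_a D x)).
Proof.
have lmap_proj q :
    lmap graph_proj q = lmap (pr_a D) q - lmap B (lmap (pr_b D) q).
  apply/malgP => k.
  by rewrite mcoeffB lmap_comp ?raddf0 // !lmap_coef ?raddf0.
rewrite lmap_proj (KlinearD _ _ (lca_linear_l brP _)) !raddfD /= pr_b_swap.
rewrite /deformed_rho /br_a /psi1.
by rewrite raddfN opprK [X in _ = _ + X]addrC addrA.
Qed.

End Graph.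

Theorem theorem4p9 (R : realType) (E a b : lmodType {poly R[i]})
    (D : direct_sum E a b) (br : E -> E -> lpoly E)
    (hE : is_quasi_twilled D br)
    (B : {linear b -> a}) (hB : is_left_deformation_map D br B) :
  is_representation (deformed_bracket D br B) (deformed_rho D br B).
Proof.
have [brP _] := hE.
have -> : deformed_bracket D br B = pullback_bracket br (graph_map D B) (pr_b D).
  by apply/funext => u; apply/funext => v; apply: deformed_bracketE.
have -> : deformed_rho D br B
        = quotient_action br (graph_map D B) (graph_proj D B) (in_a D).
  by apply/funext => u; apply/funext => x; apply: deformed_rhoE.
apply: quotient_representation => //.
- exact: graph_mapK.
- exact: graph_closed.
- exact: graph_proj_in_a.
- exact: graph_decomposition.
Qed.
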